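(* Let $A=\begin{pmatrix}1&0\\0&0\end{pmatrix}$ and let $F_A:\mathbb{R}^2\setminus\{0\}\to\mathbb{R}$ be given by $$F_A(\mathbf{w})=-\frac{\mathbf{w}^\top A\mathbf{w}}{\|\mathbf{w}\|^2}=-\frac{w_1^2}{w_1^2+w_2^2}.$$ Then for all $\mathbf{w}$ outside a set of Lebesgue measure zero, the Hessian of $F_A$ at $\mathbf{w}$ is not positive semidefinite. *)

(* Defs.v *)
From HB Require Import structures.
From mathcomp Require Import all_boot all_order all_algebra.
From mathcomp Require Import all_classical all_reals all_analysis.

Set Implicit Arguments.
Unset Strict Implicit.
Unset Printing Implicit Defensive.

Import Order.TTheory GRing.Theory Num.Theory.
Import numFieldNormedType.Exports.

Local Open Scope classical_set_scope.
Local Open Scope ring_scope.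

(* The norm `|w| that the library puts on matrices is the sup norm, so the
   Euclidean norm is defined here. *)
Definition l2norm (R : realType) (n : nat) (w : 'cV[R]_n) : R :=
  Num.sqrt (\sum_(i < n) w i 0 ^+ 2).

(* The 1 x 1 matrix w^T A w is read as the scalar it contains. *)
Definition quadform (R : realType) (n : nat) (A : 'M[R]_n) (w : 'cV[R]_n) : R :=
  (w^T *m A *m w) 0 0.

Definition possemidef (R : realType) (n : nat) (H : 'M[R]_n) : Prop :=
  forall v : 'cV[R]_n, 0 <= quadform H v.

(* The mathematical domain is the set of nonzero vectors; at w = 0 the total
   function below takes the irrelevant value 0. *)
Definition rayleigh (R : realType) (n : nat) (A : 'M[R]_n) (w : 'cV[R]_n) : R :=
  - (quadform A w / l2norm w ^+ 2).

Definition A10 (R : realType) : 'M[R]_2 := delta_mx 0 0.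

Lemma rayleigh_A10E (R : realType) (w : 'cV[R]_2) :
  rayleigh (A10 R) w = - (w 0 0 ^+ 2 / (w 0 0 ^+ 2 + w 1 0 ^+ 2)).
Proof.
rewrite /rayleigh /l2norm sqr_sqrtr; last by apply: sumr_ge0 => i _; exact: sqr_ge0.
rewrite big_ord_recl big_ord1 /quadform !mxE big_ord_recl big_ord1 !mxE.
rewrite !big_ord_recl !big_ord0 !mxE /= !mulr0 !addr0 mulr1 mul0r addr0 -expr2.
by rewrite (_ : lift ord0 ord0 = 1) //; exact/val_inj.
Qed.

Definition partial (R : realType) (n : nat) (j : 'I_n.+1)
    (f : 'cV[R]_n.+1 -> R) (w : 'cV[R]_n.+1) : R :=
  'D_(delta_mx j 0 : 'cV[R]_n.+1) f w.

Definition hessian (R : realType) (n : nat)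
    (f : 'cV[R]_n.+1 -> R) (w : 'cV[R]_n.+1) : 'M[R]_n.+1 :=
  \matrix_(i, j) partial i (partial j f) w.

Definition col2 (R : realType) (p : R * R) : 'cV[R]_2 :=
  \col_i (if i == 0 then p.1 else p.2).

(* The library's matrices carry no measurable structure, so Lebesgue measure on
   R^2 is the product measure on R * R, transported along the bijection col2.
   Negligible means contained in a measurable set of measure zero. *)
Definition lebesgue_null2 (R : realType) (N : set 'cV[R]_2) : Prop :=
  ((@lebesgue_measure R) \x (@lebesgue_measure R))%E.-negligible
    (@col2 R @^-1` N).

(* Main.v *)
Require Import Defs.
From HB Require Import structures.
From mathcomp Require Import all_boot all_order all_algebra.
From mathcomp Require Import ring lra.
From mathcomp Require Import all_classical all_reals all_analysis.
Import Order.TTheory GRing.Theory Num.Theory.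
Import numFieldNormedType.Exports.

Local Open Scope classical_set_scope.
Local Open Scope ring_scope.

(** Write w = (x, y). The quotient is constant along rays, so its gradient, 2xy / |w|^4 times (-y,
    x), is orthogonal to w and homogeneous of degree -1. By Euler's identity the Hessian H satisfies
    H w = - gradient, hence w^T H w = 0. A positive semidefinite symmetric form has its isotropic
    vectors in its kernel, so H is not semidefinite wherever the gradient is nonzero, that is, off
    the two axes. [quadform_hessian_rayleigh_A10] makes this explicit with a vector of negative
    value, computed from [is_derive_rayleigh_A10] and [is_derive_grad_A10]; [lebesgue_null2_axes]
    discards the axes. *)

Lemma is_derive_coord {R : realType} {m n : nat} (i : 'I_m.+1) (j : 'I_n.+1)
    (w v : 'M[R]_(m.+1, n.+1)) :
  is_derive w v (fun M : 'M[R]_(m.+1, n.+1) => M i j : R) (v i j).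
Proof.
have did : derivable (@id 'M[R]_(m.+1, n.+1)) w v by exact: derivable_id.
split; first exact/diff_derivable/differentiable_coord.
(* Matrix derivatives are entrywise, and the derivative of the identity along [v] is [v]. *)
by have := derive_mx did; rewrite derive_id => /matrixP/(_ i j); rewrite mxE.
Qed.

Lemma is_derive_div {R : realType} {V : normedModType R} {f g : V -> R}
    {w v : V} {df dg : R} :
  g w != 0 -> is_derive w v f df -> is_derive w v g dg ->
  is_derive w v (fun z => f z / g z) (df / g w - f w * dg / g w ^+ 2).
Proof.
move=> gw0 fd gd.
have gVd : is_derive w v (fun z => (g z)^-1) (- (g w) ^- 2 *: dg).
  split; first by apply: derivableV => //; exact: (@ex_derive _ _ _ _ _ _ _ gd).
  by rewrite deriveV // (@derive_val _ _ _ _ _ _ _ gd).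
apply: (is_derive_eq (is_deriveM fd gVd)).
by rewrite /GRing.scale /=; field.
Qed.

Definition sqnorm2 {R : realType} (w : 'cV[R]_2) : R := w 0 0 ^+ 2 + w 1 0 ^+ 2.

Lemma sqnorm2_eq0 {R : realType} (w : 'cV[R]_2) : (sqnorm2 w == 0) = (w == 0).
Proof.
rewrite /sqnorm2 paddr_eq0 ?sqr_ge0 // !sqrf_eq0.
apply/andP/eqP => [[/eqP w0 /eqP w1]|->]; last by rewrite !mxE.
apply/matrixP => i j; rewrite (ord1 j) mxE.
case: i => [[|[|//]] i2].
- by rewrite -[RHS]w0; congr (w _ _); exact/val_inj.
- by rewrite -[RHS]w1; congr (w _ _); exact/val_inj.
Qed.

(** Points are closed in a Hausdorff space. This lets a formula valid off the origin be
    differentiated at [w]. *)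
Lemma nbhs_neq0 {R : realType} {w : 'cV[R]_2} : w != 0 -> \forall z \near w, z != 0.
Proof.
move=> /eqP w0; have := @norm_hausdorff R 'cV[R]_2.
move=> /hausdorff_accessible /accessible_closed_set1 /(_ 0) /closed_openC.
move=> oC; have := open_nbhs_nbhs (conj oC w0).
by apply: filterS => z /= /eqP.
Qed.

Lemma is_derive_sqnorm2 {R : realType} (w v : 'cV[R]_2) :
  is_derive w v sqnorm2 (2 * (w 0 0 * v 0 0 + w 1 0 * v 1 0)).
Proof.
have Dx := is_derive_coord 0 0 w v; have Dy := is_derive_coord 1 0 w v.
apply: (is_derive_eq (is_deriveD (is_deriveX 2 Dx) (is_deriveX 2 Dy))).
by rewrite /GRing.scale /=; ring.
Qed.

(** Pairing of the gradient with [u]. The direction comes first so that [grad_A10 u] is a function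
    of the base point, ready to be differentiated again. *)
Definition grad_A10 {R : realType} (u w : 'cV[R]_2) : R :=
  2 * (w 0 0 * w 1 0 * (w 0 0 * u 1 0 - w 1 0 * u 0 0)) / sqnorm2 w ^+ 2.

Lemma is_derive_rayleigh_A10 {R : realType} {w : 'cV[R]_2} (u : 'cV[R]_2) :
  w != 0 -> is_derive w u (rayleigh (A10 R)) (grad_A10 u w).
Proof.
rewrite -sqnorm2_eq0 => s0.
have -> : rayleigh (A10 R) =
    - (fun z : 'cV[R]_2 => ((fun M : 'cV[R]_2 => M 0 0) ^+ 2) z / sqnorm2 z).
  by apply/funext => z; rewrite rayleigh_A10E.
have D := is_deriveN (is_derive_div s0
  (is_deriveX 2 (is_derive_coord 0 0 w u)) (is_derive_sqnorm2 w u)).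
apply: (is_derive_eq D).
rewrite /grad_A10 /GRing.scale /= !exprfctE; move: s0; rewrite /sqnorm2 => s0.
by field.
Qed.

(** Quotient rule: [sqnorm2 ^+ 2] has derivative 4 |w|^2 (w . v), one factor |w|^2 of which cancels;
    this leaves the cube and, with the leading 2, the constant 8. *)
Lemma is_derive_grad_A10 {R : realType} {w : 'cV[R]_2} (v u : 'cV[R]_2) :
  w != 0 -> is_derive w v (grad_A10 u)
   (2 * ((v 0 0 * w 1 0 + w 0 0 * v 1 0) * (w 0 0 * u 1 0 - w 1 0 * u 0 0)
       + w 0 0 * w 1 0 * (v 0 0 * u 1 0 - v 1 0 * u 0 0)) / sqnorm2 w ^+ 2
    - 8 * (w 0 0 * w 1 0 * (w 0 0 * u 1 0 - w 1 0 * u 0 0))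
      * (w 0 0 * v 0 0 + w 1 0 * v 1 0) / sqnorm2 w ^+ 3).
Proof.
rewrite -sqnorm2_eq0 => s0.
have s20 : (sqnorm2 ^+ 2) w != 0 by rewrite exprfctE expf_neq0.
have Dx := is_derive_coord 0 0 w v; have Dy := is_derive_coord 1 0 w v.
have cd (c : R) := is_derive_cst c w v.
have D := is_derive_div s20 (is_deriveM (cd 2) (is_deriveM (is_deriveM Dx Dy)
    (is_deriveB (is_deriveM Dx (cd (u 1 0))) (is_deriveM Dy (cd (u 0 0))))))
  (is_deriveX 2 (is_derive_sqnorm2 w v)).
apply: (is_derive_eq D).
rewrite /GRing.scale /= !mulrfctE !fctE /= /cst; move: s0; rewrite /sqnorm2 => s0.
by field.
Qed.

(** The closed form of the first partials is established only off the origin, but a derivative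
    depends only on the values near [w]. *)
Lemma hessian_rayleigh_A10 {R : realType} {w : 'cV[R]_2} (i j : 'I_2) :
  w != 0 ->
  hessian (rayleigh (A10 R)) w i j =
    'D_(delta_mx i 0) (grad_A10 (delta_mx j 0)) w.
Proof.
move=> w0; rewrite mxE /partial; apply: near_eq_derive.
apply: filterS (nbhs_neq0 w0) => z z0.
by have [_ ->] := is_derive_rayleigh_A10 (delta_mx j 0) z0.
Qed.

(* By degree-0 homogeneity [w] is a null vector of the Hessian form, but it is
   not in the kernel where the gradient is nonzero, so moving off [w] makes the
   form negative: the test vector is [|w|^2 w + w_1 w_2 (- w_2, w_1)]. *)
Lemma quadform_hessian_rayleigh_A10 {R : realType} {w : 'cV[R]_2} : w != 0 ->
  quadform (hessian (rayleigh (A10 R)) w)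
    (col2 (w 0 0 ^+ 3, w 1 0 * (2 * w 0 0 ^+ 2 + w 1 0 ^+ 2))) =
  - (2 * (w 0 0 * w 1 0) ^+ 2 * (w 0 0 ^+ 2 + 3 * w 1 0 ^+ 2) / sqnorm2 w).
Proof.
move=> w0; rewrite /quadform.
rewrite mxE !big_ord_recl big_ord0 !mxE !big_ord_recl !big_ord0.
rewrite (_ : lift ord0 ord0 = 1); last exact/val_inj.
rewrite ![_^T _ _]mxE ![col2 _ _ _]mxE /= !hessian_rayleigh_A10 //.
rewrite !(@derive_val _ _ _ _ _ _ _ (is_derive_grad_A10 _ _ w0)).
rewrite !mxE /= !(mulr0, mulr1, add0r, addr0, sub0r, subr0).
move: w0; rewrite -sqnorm2_eq0 /sqnorm2 => s0.
by field.
Qed.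

(** Each axis is a rectangle with a point as one side and the whole line as the other; its measure
    is a product with a factor 0, which is 0 in the extended reals even against an infinite
    factor. *)
Lemma lebesgue_null2_axes (R : realType) :
  lebesgue_null2 [set w : 'cV[R]_2 | w 0 0 = 0 \/ w 1 0 = 0].
Proof.
rewrite /lebesgue_null2.
have -> : @col2 R @^-1` [set w | w 0 0 = 0 \/ w 1 0 = 0] =
    ([set 0] `*` setT) `|` (setT `*` [set 0]).
  by apply/seteqP; split => -[x y] /=; rewrite !mxE /=; tauto.
apply: negligibleU.
- exists ([set 0] `*` setT); split => //; first exact: measurableX.
  have E : (@lebesgue_measure R [set 0%R] * @lebesgue_measure R setT = 0)%E.
    by rewrite lebesgue_measure_set1 mul0e.
  exact: etrans (product_measure1E (@lebesgue_measure R) (@lebesgue_measure R)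
    (measurable_set1 0) measurableT) E.
- exists (setT `*` [set 0]); split => //; first exact: measurableX.
  have E : (@lebesgue_measure R setT * @lebesgue_measure R [set 0%R] = 0)%E.
    by rewrite lebesgue_measure_set1 mule0.
  exact: etrans (product_measure1E (@lebesgue_measure R) (@lebesgue_measure R)
    measurableT (measurable_set1 0)) E.
Qed.

Theorem theorem3 (R : realType) :
  exists N : set 'cV[R]_2, lebesgue_null2 N /\
    forall w : 'cV[R]_2, w != 0 -> ~ N w ->
      ~ possemidef (hessian (rayleigh (A10 R)) w).
Proof.
(* On the axes the gradient vanishes and the test vector only gives the value 0. *)
exists [set w | w 0 0 = 0 \/ w 1 0 = 0]; split; first exact: lebesgue_null2_axes.
move=> w w0 /= /not_orP[/eqP x0 /eqP y0].
move=> /(_ (col2 (w 0 0 ^+ 3, w 1 0 * (2 * w 0 0 ^+ 2 + w 1 0 ^+ 2)))).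
apply/negP; rewrite quadform_hessian_rayleigh_A10 // -ltNge oppr_lt0.
have x2 : 0 < w 0 0 ^+ 2 by rewrite exprn_even_gt0.
have y2 : 0 < w 1 0 ^+ 2 by rewrite exprn_even_gt0.
rewrite exprMn; apply: divr_gt0; last exact: addr_gt0.
by apply: mulr_gt0; [apply: mulr_gt0 => //; exact: mulr_gt0 | lra].
Qed.
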